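(* There exists a real number $\omega_0 > \frac14$ such that $\left[\frac14, \omega_0\right] \subset \mathbb{I}$, where $$\mathbb{I} = \{ m\in \mathbb{R}:\ \exists\, \alpha \in \mathbb{R}\setminus\mathbb{Q} \text{ such that } \mathfrak{i}(\alpha) = m\}.$$
   Context: For an irrational real $\alpha=[a_0;a_1,a_2,\dots]$ (regular continued fraction), let $p_\nu/q_\nu$ denote its convergents, and put $\alpha_\nu=[a_\nu;a_{\nu+1},a_{\nu+2},\dots]$ and $\alpha_\nu^*=[0;a_\nu,a_{\nu-1},\dots,a_1]$. Let $Q_0<Q_1<\cdots<Q_n<Q_{n+1}<\cdots$ be the increasing sequence of those denominators $Q$ of convergents $A/Q$ (with $\gcd(A,Q)=1$) to $\alpha$ which satisfy $\left|\alpha-\frac{A}{Q}\right|<\frac{1}{2Q^2}$. Since among any two consecutive convergents at least one satisfies this inequality, for each $n$ either $(Q_n,Q_{n+1})=(q_{\nu-1},q_{\nu+1})$ for some $\nu$, or $(Q_n,Q_{n+1})=(q_\nu,q_{\nu+1})$ for some $\nu$. Define $$G(x,y)=\frac{x+y+1}{4},\qquad F(x,y)=\frac{(1-xy)^2}{4(1+xy)(1-x)(1-y)},$$ and $$\mathfrak{m}_n(\alpha)=\begin{cases} G(\alpha_\nu^*,\alpha_{\nu+2}^{-1}) & \text{if } (Q_n,Q_{n+1})=(q_{\nu-1},q_{\nu+1}) \text{ for some } \nu,\\ F(\alpha_{\nu+1}^*,\alpha_{\nu+2}^{-1}) & \text{if } (Q_n,Q_{n+1})=(q_{\nu},q_{\nu+1})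 \text{ for some } \nu.\end{cases}$$ Finally set $\mathfrak{i}(\alpha)=\liminf_{n\to\infty}\mathfrak{m}_n(\alpha)$. *)

(* Defs.v *)
From Stdlib Require Export Reals ZArith Qreals ClassicalEpsilon.
From Coquelicot Require Export Coquelicot.
Open Scope R_scope.

Definition irrational (alpha : R) : Prop := ~ exists r : Q, alpha = Q2R r.

(* alpha_nu = [a_nu; a_{nu+1}, ...] *)
Fixpoint complete_quotient (alpha : R) (nu : nat) : R :=
  match nu with
  | O => alpha
  | S k => / (complete_quotient alpha k - IZR (Int_part (complete_quotient alpha k)))
  end.

(* a_nu *)
Definition partial_quotient (alpha : R) (nu : nat) : Z :=
  Int_part (complete_quotient alpha nu).

Fixpoint cf_num (alpha : R) (nu : nat) : Z :=
  match nu with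
  | O => partial_quotient alpha 0
  | S O => partial_quotient alpha 1 * partial_quotient alpha 0 + 1
  | S (S k as l) => partial_quotient alpha nu * cf_num alpha l + cf_num alpha k
  end%Z.

Fixpoint cf_den (alpha : R) (nu : nat) : Z :=
  match nu with
  | O => 1
  | S O => partial_quotient alpha 1
  | S (S k as l) => partial_quotient alpha nu * cf_den alpha l + cf_den alpha k
  end%Z.

Definition convergent (alpha : R) (nu : nat) : R :=
  IZR (cf_num alpha nu) / IZR (cf_den alpha nu).

(* alpha_nu^* = [0; a_nu, a_{nu-1}, ..., a_1]; the empty expansion (nu = 0) is 0. *)
Fixpoint alpha_star (alpha : R) (nu : nat) : R :=
  match nu with
  | O => 0
  | S k => / (IZR (partial_quotient alpha nu) + alpha_star alpha k)
  end.

Definition good_denominator (alpha : R) (q : Z) : Prop :=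
  (0 < q)%Z /\
  exists A : Z,
    Z.gcd A q = 1%Z /\
    (exists nu : nat, IZR A / IZR q = convergent alpha nu) /\
    Rabs (alpha - IZR A / IZR q) < 1 / (2 * IZR q ^ 2).

Definition increasing_enumeration (D : Z -> Prop) (u : nat -> Z) : Prop :=
  (forall n : nat, (u n < u (n + 1)%nat)%Z) /\
  (forall q : Z, D q <-> exists n : nat, u n = q).

(* The sequence Q_0 < Q_1 < ...; for irrational alpha the good denominators
   form an infinite set of positive integers, so the enumeration exists and is
   unique. *)
Definition Qseq (alpha : R) : nat -> Z :=
  epsilon (inhabits (fun _ : nat => 0%Z))
    (increasing_enumeration (good_denominator alpha)).

Definition G (x y : R) : R := (x + y + 1) / 4.

Definition F (x y : R) : R :=
  (1 - x * y) ^ 2 / (4 * (1 + x * y) * (1 - x) * (1 - y)).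

(* (Q_n, Q_{n+1}) = (q_{nu-1}, q_{nu+1}) *)
Definition skip_pair (alpha : R) (n nu : nat) : Prop :=
  (1 <= nu)%nat /\
  Qseq alpha n = cf_den alpha (nu - 1) /\
  Qseq alpha (n + 1) = cf_den alpha (nu + 1).

(* (Q_n, Q_{n+1}) = (q_nu, q_{nu+1}) *)
Definition consecutive_pair (alpha : R) (n nu : nat) : Prop :=
  Qseq alpha n = cf_den alpha nu /\
  Qseq alpha (n + 1) = cf_den alpha (nu + 1).

(* The two cases are mutually exclusive and determine nu, except that for
   a_1 = 1 one has q_0 = q_1 = 1, so that (Q_0, Q_1) = (1, q_2) has both forms.
   Then p_1/q_1, and not p_0/q_0, satisfies the inequality defining Q_0 = 1, so
   the consecutive form is the relevant one and is tested first. Only n = 0 is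
   concerned. *)
Definition m_seq (alpha : R) (n : nat) : R :=
  if excluded_middle_informative (exists nu : nat, consecutive_pair alpha n nu)
  then
    let nu := epsilon (inhabits 0%nat) (consecutive_pair alpha n) in
    F (alpha_star alpha (nu + 1)) (/ complete_quotient alpha (nu + 2))
  else
    let nu := epsilon (inhabits 0%nat) (skip_pair alpha n) in
    G (alpha_star alpha nu) (/ complete_quotient alpha (nu + 2)).

Definition i_inf (alpha : R) : Rbar := LimInf_seq (m_seq alpha).

Definition spectrum_I (m : R) : Prop :=
  exists alpha : R, irrational alpha /\ i_inf alpha = Finite m.

(* Main.v *)
Require Import Defs.
From Stdlib Require Import Lra Lia Psatz List Znumtheory FunctionalExtensionality.
Import ListNotations.
Open Scope R_scope.

(** The convergent with index [n] satisfies the inequality iff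
    [2 < alpha_(n+1) + alpha_n^*], so at a pattern [a, 1, b] of partial quotients
    with [a, b >= 6] it is skipped and [4 m_n - 1 = x + y], where
    [x = [0; a, ...]] is read to the left and [y = [0; b, ...]] to the right.
    At every place where one of the two digits concerned is at most 5 one has
    [m_n >= 25/96], because
    [4 F(x, y) - 1 = (x (1-y)^2 + y (1-x)^2) / ((1+xy)(1-x)(1-y))].
    Hence if [alpha] is a concatenation of blocks, the [k]-th one consisting of
    digits at most 5 around a single pattern [a_k, 1, b_k] whose value of [x + y]
    is within [1/(k+1)] of [t], then [liminf m_n = (1 + t) / 4] for
    [0 <= t <= 1/24].

    Such blocks exist for [t = 0] by taking [a_k, b_k] large. For [t > 0] this is
    M. Hall's argument: the expansions [0; a, ...] with further digits in [1..5]
    form a Cantor set whose gaps are never longer than the adjacent bridges, so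
    that sums of two such sets with [b = a] or [b = a + 1] fill an interval, and
    these intervals cover [0 < t <= 1/24]. *)

(** * Sums of Cantor sets *)

Section Gap_splitting.

Variables (T : Type) (lo hi gap : T -> R) (lam : R).
Hypothesis lam_range : 0 < lam < 1.

(** Hall's condition: neither child is shorter than the hole between them. The children may reach
    beyond the ends of the parent, and the factor [lam] bounds how often a node has to be split. *)
Definition splits (V : T -> Prop) : Prop :=
  forall n, V n -> exists l r, V l /\ V r /\
    lo l <= lo n /\ hi n <= hi r /\ lo r <= hi l + gap n /\
    gap n <= hi l - lo l /\ gap n <= hi r - lo r /\
    gap l <= lam * gap n /\ gap r <= lam * gap n /\ 0 <= gap n.

(* Always splitting the node with the larger gap keeps each gap no longer than
   the other interval, so that no gap can separate the target from the sum. *)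
Lemma sum_of_gap_intervals (V W : T -> Prop) (t d : R) :
  splits V -> splits W -> 0 < d ->
  forall k n1 n2 k1 k2, (k1 + k2 <= k)%nat ->
  V n1 -> W n2 -> gap n1 * lam ^ k1 <= d -> gap n2 * lam ^ k2 <= d ->
  gap n1 <= hi n2 - lo n2 -> gap n2 <= hi n1 - lo n1 ->
  lo n1 + lo n2 <= t <= hi n1 + hi n2 ->
  exists m1 m2, V m1 /\ W m2 /\ gap m1 <= d /\ gap m2 <= d /\
    lo m1 + lo m2 <= t <= hi m1 + hi m2.
Proof.
  intros HV HW Hd.
  (* [k1] and [k2] bound how often each node can still be split before its gap drops to [d]. *)
  induction k as [|k IH]; intros n1 n2 k1 k2 Hk V1 W2 G1 G2 C1 C2 Ht.
  - assert (k1 = 0%nat) by lia; assert (k2 = 0%nat) by lia; subst.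
    simpl in G1, G2. exists n1, n2. repeat split; auto; lra.
  - destruct (Rle_dec (gap n1) d) as [D1|D1];
      [destruct (Rle_dec (gap n2) d) as [D2|D2]; [exists n1, n2; tauto|]|].
    all: destruct (HV n1 V1) as (l1 & r1 & L1 & L2 & L3 & L4 & L5 & L6 & L7 & L8 & L9 & L10).
    all: destruct (HW n2 W2) as (l2 & r2 & M1 & M2 & M3 & M4 & M5 & M6 & M7 & M8 & M9 & M10).
    (* Three cases survive: the second node is split in the first two, the first node in the
       last. *)
    all: destruct (Rle_dec (gap n1) (gap n2)) as [D|D]; try lra.
    1, 2: destruct k2 as [|k2]; [simpl in G2; lra|].
    3: destruct k1 as [|k1]; [simpl in G1; lra|].
    (* If [t] exceeds [hi n1 + hi l2], it is still at least [lo n1 + lo r2], because the hole is at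
       most [gap n2], hence at most [hi n1 - lo n1]. *)
    1, 2: pose proof (pow_lt lam k2 ltac:(lra)); simpl in G2;
      destruct (Rle_dec t (hi n1 + hi l2));
      [apply (IH n1 l2 k1 k2) | apply (IH n1 r2 k1 k2)]; auto; try lia; try nra.
    pose proof (pow_lt lam k1 ltac:(lra)); simpl in G1;
      destruct (Rle_dec t (hi l1 + hi n2));
      [apply (IH l1 n2 k1 k2) | apply (IH r1 n2 k1 k2)]; auto; try lia; try nra.
Qed.

End Gap_splitting.

(** * Finite continued fractions as Moebius maps *)

Fixpoint cfv (U : list Z) (s : R) : R :=
  match U with
  | [] => s
  | c :: U' => / (IZR c + cfv U' s)
  end.

(** For nonempty [U], the last two convergents of [0; U] are [p / q] and [p' / q']. The determinant
    [e] tells whether the map increases or decreases in [s]. *)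
Definition represents (U : list Z) (p p' q q' e : R) : Prop :=
  (forall s, 0 <= s <= 1 -> cfv U s = (p + p' * s) / (q + q' * s)) /\
  p' * q - p * q' = e /\ (e = 1 \/ e = -1) /\ 0 <= q' <= q /\ 1 <= q.

Lemma cfv_app (U V : list Z) (s : R) : cfv (U ++ V) s = cfv U (cfv V s).
Proof. induction U as [|c U IH]; simpl; congruence. Qed.

Lemma represents_singleton (a : Z) :
  (1 <= a)%Z -> represents [a] 1 0 (IZR a) 1 (-1).
Proof.
  intros Ha; apply IZR_le in Ha.
  unfold represents; repeat split; try lra.
  intros s Hs; simpl. field. lra.
Qed.

Lemma represents_snoc (U : list Z) (c : Z) (p p' q q' e : R) :
  (1 <= c)%Z -> represents U p p' q q' e ->
  represents (U ++ [c]) (IZR c * p + p') p (IZR c * q + q') q (- e).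
Proof.
  intros Hc (Hv & He & Hs & Hq & Hq1); apply IZR_le in Hc.
  unfold represents; repeat split; try nra.
  - intros s Hs'. rewrite cfv_app; simpl. rewrite Hv.
    + field. split; nra.
    + split; [apply Rlt_le, Rinv_0_lt_compat; lra|].
      rewrite <- Rinv_1. apply Rinv_le_contravar; lra.
Qed.

(** Of the numerators only the determinant [e] survives. In the reciprocal coordinate, lengths under
    a common [U] are thus compared through [y - x] and the factors [q * x + q'] alone. *)
Lemma represents_sub (U : list Z) (p p' q q' e x y : R) :
  represents U p p' q q' e -> 1 <= x -> 1 <= y ->
  cfv U (/ x) - cfv U (/ y) = e * ((y - x) / ((q * x + q') * (q * y + q'))).
Proof.
  intros (Hv & He & Hs & Hq & Hq1) Hx Hy.
  rewrite !Hv; [subst e; field; repeat split; nra| |];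
  (split; [apply Rlt_le, Rinv_0_lt_compat; lra|];
   rewrite <- Rinv_1; apply Rinv_le_contravar; lra).
Qed.

Lemma represents_diameter (U : list Z) (p p' q q' e s t : R) :
  represents U p p' q q' e -> 0 <= s <= 1 -> 0 <= t <= 1 ->
  Rabs (cfv U s - cfv U t) <= / (q * q).
Proof.
  intros (Hv & He & Hs & Hq & Hq1) H1 H2.
  rewrite !Hv by assumption.
  replace (_ - _) with (e * ((s - t) / ((q + q' * s) * (q + q' * t))))
    by (subst e; field; split; nra).
  rewrite Rabs_mult.
  replace (Rabs e) with 1
    by (destruct Hs; subst e; rewrite H; [rewrite Rabs_R1|rewrite Rabs_left]; lra).
  assert (0 < (q + q' * s) * (q + q' * t)) by (apply Rmult_lt_0_compat; nra).
  unfold Rdiv; rewrite Rmult_1_l, Rabs_mult, Rabs_inv, (Rabs_right (_ * _)) by lra.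
  assert (Rabs (s - t) <= 1) by (apply Rabs_le; lra).
  apply Rle_trans with (1 * / ((q + q' * s) * (q + q' * t))).
  - apply Rmult_le_compat_r; [apply Rlt_le, Rinv_0_lt_compat|]; assumption.
  - rewrite Rmult_1_l. apply Rinv_le_contravar; [nra|].
    apply Rmult_le_compat; nra.
Qed.

(** * Cantor sets of expansions with digits at most 5 *)

Definition digit (c : Z) : Prop := (1 <= c <= 5)%Z.

(* The node [(U, j)] stands for the expansions [0; U, c, ...] with [c >= j].
   Its interval is the image of [1/5 <= s <= 1 / (j + 1/5)]; for [j = 1] this is
   [1/5, 5/6], which [s -> 1 / (c + s)] maps onto the reciprocals of
   [c + 1/5, c + 5/6]. *)
Definition node_lo (n : list Z * Z) : R :=
  Rmin (cfv (fst n) (/ 5)) (cfv (fst n) (/ (IZR (snd n) + 1 / 5))).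
Definition node_hi (n : list Z * Z) : R :=
  Rmax (cfv (fst n) (/ 5)) (cfv (fst n) (/ (IZR (snd n) + 1 / 5))).
(** In the coordinate [c + s], the digit [c = j] ends at [j + 5/6] and the next one starts at
    [j + 1 + 1/5]; this is the hole between them. *)
Definition node_gap (n : list Z * Z) : R :=
  Rabs (cfv (fst n) (/ (IZR (snd n) + 5 / 6)) - cfv (fst n) (/ (IZR (snd n) + 6 / 5))).

(** [snd n = 5] is excluded since a single digit would remain; the child with digit 5 takes the
    place of such a node. *)
Definition node_over (a : Z) (n : list Z * Z) : Prop :=
  (exists U, fst n = a :: U /\ Forall digit U) /\ (1 <= snd n <= 4)%Z /\
  exists p p' q q' e, represents (fst n) p p' q q' e.

Lemma Rdiv_le_cross (a b c d : R) : 0 < b -> 0 < d -> a * d <= c * b -> a / b <= c / d.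
Proof.
  intros Hb Hd H.
  apply (Rmult_le_reg_r (b * d)); [nra|].
  replace (a / b * (b * d)) with (a * d) by (field; lra).
  replace (c / d * (b * d)) with (c * b) by (field; lra). exact H.
Qed.

Lemma node_over_child (a c : Z) (n : list Z * Z) :
  node_over a n -> digit c -> node_over a (fst n ++ [c], 1%Z).
Proof.
  intros ((U & HU & FU) & Hj & p & p' & q & q' & e & Hr) Hc.
  split; [|split]; simpl; [|lia|].
  - exists (U ++ [c]); split; [rewrite HU; reflexivity|].
    apply Forall_app; auto.
  - do 5 eexists. apply represents_snoc; [unfold digit in Hc; lia|exact Hr].
Qed.

(** Brings the ends of a child and of its first hole under the prefix [U] of the parent, so that all
    lengths share the same [q] and [q']. *)
Lemma child_endpoints (U : list Z) (c : Z) : (1 <= c)%Z ->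
  cfv (U ++ [c]) (/ 5) = cfv U (/ (IZR c + 1 / 5)) /\
  cfv (U ++ [c]) (/ (1 + 1 / 5)) = cfv U (/ (IZR c + 5 / 6)) /\
  cfv (U ++ [c]) (/ (1 + 5 / 6)) = cfv U (/ (IZR c + 6 / 11)) /\
  cfv (U ++ [c]) (/ (1 + 6 / 5)) = cfv U (/ (IZR c + 5 / 11)).
Proof.
  intros Hc. rewrite !cfv_app; simpl.
  repeat split; do 2 f_equal; field.
Qed.

(** After cross-multiplication each condition on lengths is a quadratic inequality in [q] and [q']
    with [0 <= q' <= q], checked for each [j] from 1 to 4. *)
Lemma node_over_splits (a : Z) :
  splits (list Z * Z) node_lo node_hi node_gap (4 / 5) (node_over a).
Proof.
  intros [U j] Hn.
  pose proof Hn as ((U0 & HU & FU) & Hj & p & p' & q & q' & e & Hr); simpl in *.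
  pose proof Hr as (_ & _ & Hs & Hq & Hq1).
  assert (HA : node_over a (U ++ [j], 1%Z))
    by (apply (node_over_child a j (U, j)); [exact Hn|unfold digit; lia]).
  assert (HA' : node_over a (U ++ [5%Z], 1%Z))
    by (apply (node_over_child a 5 (U, j)); [exact Hn|unfold digit; lia]).
  destruct (child_endpoints U j ltac:(lia)) as (E1 & E2 & E3 & E4).
  destruct (child_endpoints U 5 ltac:(lia)) as (F1 & F2 & F3 & F4).
  assert (HD : forall x y, 1 <= x -> x <= y ->
     cfv U (/ x) - cfv U (/ y) = e * ((y - x) / ((q * x + q') * (q * y + q'))) /\
     0 <= (y - x) / ((q * x + q') * (q * y + q'))).
  { intros x y Hx Hy. split; [apply (represents_sub _ p p'); auto; lra|].
    apply Rmult_le_pos; [lra|]. apply Rlt_le, Rinv_0_lt_compat.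
    apply Rmult_lt_0_compat; nra. }
  assert (HC : forall x y x1 y1 k, 0 <= k -> 1 <= x -> x <= y -> 1 <= x1 -> x1 <= y1 ->
     (y - x) * ((q * x1 + q') * (q * y1 + q')) <=
       k * (y1 - x1) * ((q * x + q') * (q * y + q')) ->
     (y - x) / ((q * x + q') * (q * y + q')) <=
     k * ((y1 - x1) / ((q * x1 + q') * (q * y1 + q')))).
  { intros. unfold Rdiv at 2. rewrite <- Rmult_assoc.
    apply Rdiv_le_cross; auto; apply Rmult_lt_0_compat; nra. }
  assert (Hcase : (j = 1 \/ j = 2 \/ j = 3 \/ j = 4)%Z) by lia.
  (* [A] is the child [(U ++ [j], 1)] and [B] the rest of the node *)
  pose (A := (U ++ [j], 1%Z)).
  pose (B := if (j =? 4)%Z then (U ++ [5%Z], 1%Z) else (U, (j + 1)%Z)).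
  pose (J := IZR j).
  (* The far end of [B]. For [j = 4] it is the end of the child with digit 5, which lies beyond the
     end 5 of the parent. *)
  pose (b1 := if (j =? 4)%Z then 5 + 5 / 6 else 5).
  assert (b1J : J + 6 / 5 <= b1 /\ 5 <= b1 /\ 1 <= J).
  { unfold b1, J; destruct Hcase as [->|[->|[->| ->]]]; simpl; lra. }
  assert (VB : node_over a B).
  { unfold B; destruct (Z.eqb_spec j 4); [exact HA'|].
    split; [|split]; simpl; [eauto|lia|]. do 5 eexists; exact Hr. }
  pose (f := fun x => cfv U (/ x)).
  assert (LA : node_lo A = Rmin (f (J + 1/5)) (f (J + 5/6))
            /\ node_hi A = Rmax (f (J + 1/5)) (f (J + 5/6))).
  { unfold node_lo, node_hi, A, f; simpl. now rewrite E1, E2. }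
  assert (LB : node_lo B = Rmin (f b1) (f (J + 6/5))
            /\ node_hi B = Rmax (f b1) (f (J + 6/5))).
  { unfold node_lo, node_hi, B, f, b1, J; destruct (Z.eqb_spec j 4); simpl.
    - subst j. rewrite F1, F2.
      replace (4 + 6/5) with (5 + 1/5) by lra.
      rewrite Rmin_comm, Rmax_comm; auto.
    - rewrite plus_IZR. replace (IZR j + 1 + 1/5) with (IZR j + 6/5) by lra; auto. }
  assert (GA : node_gap A = Rabs (f (J + 5/11) - f (J + 6/11))).
  { unfold node_gap, A, f; simpl. rewrite E3, E4. apply Rabs_minus_sym. }
  (* The hole of [B] has two shapes: the first hole of the child with digit 5 if [j = 4], the next
     hole under [U] otherwise. The last clause is the cross-multiplied bound by 4/5 of the parent's
     hole. *)
  assert (GB : exists x y, 1 <= x <= y /\ node_gap B = Rabs (f x - f y) /\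
     (y - x) * ((q * (J + 5/6) + q') * (q * (J + 6/5) + q')) <=
       4/5 * (J + 6/5 - (J + 5/6)) * ((q * x + q') * (q * y + q'))).
  { unfold node_gap, B, f, J; destruct (Z.eqb_spec j 4); simpl.
    - exists (5 + 5/11), (5 + 6/11). split; [lra|]. split.
      + rewrite F3, F4. apply Rabs_minus_sym.
      + subst j; nra.
    - exists (IZR j + 11/6), (IZR j + 11/5).
      assert (1 <= IZR j <= 3) by (split; apply IZR_le; lia).
      split; [lra|]. split.
      + rewrite plus_IZR.
        replace (IZR j + 1 + 5 / 6) with (IZR j + 11/6) by lra.
        replace (IZR j + 1 + 6 / 5) with (IZR j + 11/5) by lra. reflexivity.
      + destruct Hcase as [->|[->|[->| ->]]]; try lia; nra. }
  destruct GB as (x & y & Hxy & GB & GB').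
  assert (Gn : node_gap (U, j) = Rabs (f (J + 5/6) - f (J + 6/5))) by reflexivity.
  assert (Ln : node_lo (U, j) = Rmin (f 5) (f (J + 1/5)) /\
               node_hi (U, j) = Rmax (f 5) (f (J + 1/5))) by (split; reflexivity).
  destruct (HD (J + 1/5) (J + 5/6)) as [A1 A2]; try lra.
  destruct (HD (J + 5/6) (J + 6/5)) as [A3 A4]; try lra.
  destruct (HD (J + 6/5) b1) as [A5 A6]; try lra.
  destruct (HD 5 b1) as [A7 A8]; try lra.
  destruct (HD (J + 5/11) (J + 6/11)) as [A9 A10]; try lra.
  destruct (HD x y) as [A11 A12]; try lra.
  destruct (HD (J + 1/5) 5) as [A13 A14]; [lra| |].
  { unfold J; destruct Hcase as [->|[->|[->| ->]]]; lra. }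
  (* In order: the hole is at most the length of [A] and of [B], and the holes of [A] and of [B] are
     at most 4/5 of it. *)
  assert (I1 := HC (J + 5/6) (J + 6/5) (J + 1/5) (J + 5/6) 1).
  assert (I2 := HC (J + 5/6) (J + 6/5) (J + 6/5) b1 1).
  assert (I3 := HC (J + 5/11) (J + 6/11) (J + 5/6) (J + 6/5) (4/5)).
  assert (I4 := HC x y (J + 5/6) (J + 6/5) (4/5)).
  specialize (I1 ltac:(lra) ltac:(lra) ltac:(lra) ltac:(lra) ltac:(lra)).
  specialize (I2 ltac:(lra) ltac:(lra) ltac:(lra) ltac:(lra) ltac:(lra)).
  specialize (I3 ltac:(lra) ltac:(lra) ltac:(lra) ltac:(lra) ltac:(lra)).
  specialize (I4 ltac:(lra) ltac:(lra) ltac:(lra) ltac:(lra) ltac:(lra) GB').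
  assert (H1 : 1 * (J + 5/6 - (J + 1/5)) = 19/30) by lra.
  assert (H2 : J + 6/5 - (J + 5/6) = 11/30) by lra.
  assert (I1p : (J + 6/5 - (J + 5/6)) * ((q * (J + 1/5) + q') * (q * (J + 5/6) + q')) <=
     1 * (J + 5/6 - (J + 1/5)) * ((q * (J + 5/6) + q') * (q * (J + 6/5) + q'))).
  { rewrite H1, H2. clear - Hq Hq1 Hcase. unfold J.
    destruct Hcase as [->|[->|[->| ->]]]; nra. }
  specialize (I1 I1p).
  assert (I2p : (J + 6/5 - (J + 5/6)) * ((q * (J + 6/5) + q') * (q * b1 + q')) <=
     1 * (b1 - (J + 6/5)) * ((q * (J + 5/6) + q') * (q * (J + 6/5) + q'))).
  { rewrite H2. clear - Hq Hq1 Hcase. unfold b1, J.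
    destruct Hcase as [->|[->|[->| ->]]]; simpl; nra. }
  specialize (I2 I2p).
  assert (I3p : (J + 6/11 - (J + 5/11)) * ((q * (J + 5/6) + q') * (q * (J + 6/5) + q')) <=
     4/5 * (J + 6/5 - (J + 5/6)) * ((q * (J + 5/11) + q') * (q * (J + 6/11) + q'))).
  { clear - Hq Hq1 Hcase. unfold J.
    destruct Hcase as [->|[->|[->| ->]]]; simpl; nra. }
  specialize (I3 I3p).
  clear HD HC I1p I2p I3p GB' E1 E2 E3 E4 F1 F2 F3 F4 HA' H1 H2.
  fold (f (J + 1/5)) (f (J + 5/6)) (f (J + 6/5)) (f b1) (f 5)
       (f (J + 5/11)) (f (J + 6/11)) (f x) (f y) in A1, A3, A5, A7, A9, A11, A13.
  destruct LA as [LA1 LA2], LB as [LB1 LB2], Ln as [Ln1 Ln2].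
  set (D1 := (_ / ((q * (J + 1/5) + q') * (q * (J + 5/6) + q')))) in *.
  set (D2 := (_ / ((q * (J + 5/6) + q') * (q * (J + 6/5) + q')))) in *.
  set (D3 := (_ / ((q * (J + 6/5) + q') * (q * b1 + q')))) in *.
  set (D4 := (_ / ((q * 5 + q') * (q * b1 + q')))) in *.
  set (D5 := (_ / ((q * (J + 5/11) + q') * (q * (J + 6/11) + q')))) in *.
  set (D6 := (_ / ((q * x + q') * (q * y + q')))) in *.
  set (D7 := (_ / ((q * (J + 1/5) + q') * (q * 5 + q')))) in *.
  rewrite A9 in GA; rewrite A11 in GB; rewrite A3 in Gn.
  (* The sign decides the orientation: for [e = 1] the map [f] decreases, so [B] is the left child;
     for [e = -1] it is [A]. *)
  destruct Hs as [He|He]; rewrite He in *.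
  - rewrite Rabs_pos_eq in GA, GB, Gn by lra.
    rewrite Rmin_right in LA1 by lra. rewrite Rmax_left in LA2 by lra.
    rewrite Rmin_left in LB1, Ln1 by lra. rewrite Rmax_right in LB2, Ln2 by lra.
    exists B, A. rewrite LA1, LA2, LB1, LB2, Ln1, Ln2, GA, GB, Gn.
    split; [exact VB|]. split; [exact HA|]. repeat split; lra.
  - rewrite Rabs_left1 in GA, GB, Gn by lra.
    rewrite Rmin_left in LA1 by lra. rewrite Rmax_right in LA2 by lra.
    rewrite Rmin_right in LB1, Ln1 by lra. rewrite Rmax_left in LB2, Ln2 by lra.
    exists A, B. rewrite LA1, LA2, LB1, LB2, Ln1, Ln2, GA, GB, Gn.
    split; [exact HA|]. split; [exact VB|]. repeat split; lra.
Qed.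

Lemma node_over_root (a : Z) : (1 <= a)%Z -> node_over a ([a], 1%Z).
Proof.
  intros Ha; split; [|split]; simpl; [|lia|].
  - exists []; auto.
  - do 5 eexists; now apply represents_singleton.
Qed.

Lemma root_size (a : Z) : (1 <= a)%Z ->
  node_lo ([a], 1%Z) = / (IZR a + 5 / 6) /\ node_hi ([a], 1%Z) = / (IZR a + 1 / 5).
Proof.
  intros Ha; apply IZR_le in Ha. unfold node_lo, node_hi; simpl.
  replace (/ (1 + 1 / 5)) with (5 / 6) by field.
  replace (/ 5) with (1 / 5) by field.
  assert (/ (IZR a + 5 / 6) <= / (IZR a + 1 / 5)) by (apply Rinv_le_contravar; lra).
  rewrite Rmin_right, Rmax_left by assumption. auto.
Qed.

(** The starting condition of Hall's argument: a hole of about (1/11) / a^2 against an interval of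
    about (19/30) / b^2, which leaves room for digits differing by 1. *)
Lemma root_gap (a b : Z) : (40 <= a)%Z -> (40 <= b)%Z -> (a - 1 <= b <= a + 1)%Z ->
  node_gap ([a], 1%Z) <= node_hi ([b], 1%Z) - node_lo ([b], 1%Z).
Proof.
  intros Ha Hb Hab.
  destruct (root_size b) as [-> ->]; [lia|].
  apply IZR_le in Ha; apply IZR_le in Hb.
  destruct Hab as [H1 H2]; apply IZR_le in H1; apply IZR_le in H2.
  rewrite minus_IZR in H1; rewrite plus_IZR in H2.
  unfold node_gap; simpl.
  replace (/ (1 + 5 / 6)) with (6 / 11) by field.
  replace (/ (1 + 6 / 5)) with (5 / 11) by field.
  replace (/ (IZR a + 6 / 11) - / (IZR a + 5 / 11))
    with (- ((1 / 11) / ((IZR a + 6 / 11) * (IZR a + 5 / 11)))) by (field; lra).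
  replace (/ (IZR b + 1 / 5) - / (IZR b + 5 / 6))
    with ((19 / 30) / ((IZR b + 1 / 5) * (IZR b + 5 / 6))) by (field; lra).
  rewrite Rabs_Ropp, Rabs_pos_eq.
  - apply Rdiv_le_cross; nra.
  - apply Rmult_le_pos; [lra|]. apply Rlt_le, Rinv_0_lt_compat; nra.
Qed.

(** The image of [0, 1] has diameter at most 1 / q^2. As [j <= 4] and [q' <= q], the gap is at least
    (11/30) / ((35/6) (31/5) q^2), and (35/6) (31/5) (30/11) < 100. *)
Lemma node_over_diameter (a : Z) (n : list Z * Z) (s : R) :
  node_over a n -> 0 <= s <= 1 ->
  node_hi n - 100 * node_gap n <= cfv (fst n) s <= node_lo n + 100 * node_gap n.
Proof.
  destruct n as [U j]. intros (_ & Hj & p & p' & q & q' & e & Hr) Hs; simpl in *.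
  assert (D : forall t, 0 <= t <= 1 -> Rabs (cfv U s - cfv U t) <= / (q * q))
    by (intros t Ht; eapply represents_diameter; eauto).
  destruct Hj as [Hj1 Hj2]; apply IZR_le in Hj1; apply IZR_le in Hj2.
  assert (Hg : / (q * q) <= 100 * node_gap (U, j)).
  { unfold node_gap; simpl. erewrite represents_sub; [|exact Hr|lra|lra].
    destruct Hr as (_ & _ & He & Hq & Hq1).
    set (J := IZR j) in *.
    assert (0 < (q * (J + 5 / 6) + q') * (q * (J + 6 / 5) + q'))
      by (apply Rmult_lt_0_compat; nra).
    rewrite Rabs_mult. replace (Rabs e) with 1
      by (destruct He as [-> | ->]; [rewrite Rabs_R1|rewrite Rabs_left]; lra).
    replace (J + 6 / 5 - (J + 5 / 6)) with (11 / 30) by lra.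
    rewrite Rmult_1_l, Rabs_pos_eq
      by (apply Rmult_le_pos; [lra|]; apply Rlt_le, Rinv_0_lt_compat; assumption).
    rewrite <- (Rmult_1_l (/ (q * q))). unfold Rdiv at 1. rewrite <- Rmult_assoc.
    apply Rdiv_le_cross; [nra|assumption|].
    assert ((q * (J + 5 / 6) + q') * (q * (J + 6 / 5) + q') <= (35/6 * q) * (31/5 * q))
      by (apply Rmult_le_compat; nra).
    nra. }
  pose proof (D (/ 5) ltac:(lra)) as D1.
  assert (R2 : 0 <= / (IZR j + 1 / 5) <= 1).
  { split; [apply Rlt_le, Rinv_0_lt_compat; lra|].
    rewrite <- Rinv_1; apply Rinv_le_contravar; lra. }
  pose proof (D _ R2) as D2.
  unfold node_lo, node_hi; simpl.
  apply Rabs_le_between in D1; apply Rabs_le_between in D2.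
  unfold Rmin, Rmax; destruct Rle_dec; lra.
Qed.

(** With z = 2 / t >= 48 and a the integer part of z - 1/5, one has a + 1/5 <= z < a + 6/5. The pair
    (a, a) serves z up to a + 5/6, and (a, a + 1) serves the rest. *)
Lemma harmonic_cover (t : R) : 0 < t <= 1 / 24 ->
  exists a b : Z, (40 <= a)%Z /\ (40 <= b)%Z /\ (a <= b <= a + 1)%Z /\
    / (IZR a + 5 / 6) + / (IZR b + 5 / 6) <= t <= / (IZR a + 1 / 5) + / (IZR b + 1 / 5).
Proof.
  intros [Ht Ht'].
  assert (Hz : 48 <= 2 / t).
  { apply (Rmult_le_reg_r t); [lra|]. replace (2 / t * t) with 2 by (field; lra). lra. }
  assert (Et : t = 2 / (2 / t)) by (field; lra).
  set (z := 2 / t) in *. rewrite Et; clear Et.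
  pose proof (base_Int_part (z - 1 / 5)) as [B1 B2].
  set (a := Int_part (z - 1 / 5)) in *.
  assert (Ha : (40 <= a)%Z).
  { apply le_IZR. destruct (Z_lt_le_dec a 40) as [L|L]; [|now apply IZR_le].
    assert (a <= 39)%Z as L' by lia. apply IZR_le in L'. lra. }
  pose proof (IZR_le _ _ Ha) as Ha'.
  set (A := IZR a) in *.
  assert (Hdiv : forall x y, 0 < x -> 0 < y -> / x + / y = (x + y) / (x * y))
    by (intros; field; lra).
  destruct (Rle_dec z (A + 5 / 6)) as [C|C].
  - exists a, a. split; [exact Ha|]. split; [exact Ha|]. split; [lia|]. fold A.
    rewrite !Hdiv by lra. split; apply Rdiv_le_cross; nra.
  - exists a, (a + 1)%Z. split; [exact Ha|]. split; [lia|]. split; [lia|].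
    rewrite plus_IZR; fold A.
    rewrite !Hdiv by lra. split; apply Rdiv_le_cross; try nra.
Qed.

(** Uniformity in the tails [s] and [s'] lets the finite words be placed inside any longer
    expansion. *)
Lemma small_sum_approximation (t d : R) : 0 <= t <= 1 / 24 -> 0 < d ->
  exists (a b : Z) (U V : list Z), (6 <= a)%Z /\ (6 <= b)%Z /\
    Forall digit U /\ Forall digit V /\
    forall s s', 0 <= s <= 1 -> 0 <= s' <= 1 ->
      Rabs (cfv (a :: U) s + cfv (b :: V) s' - t) <= d.
Proof.
  intros Ht Hd. destruct (Req_dec t 0) as [->|Ht0].
  - pose proof (archimed (2 / d)) as [Hu _].
    set (a := Z.max 6 (up (2 / d))).
    exists a, a, [], []. repeat split; auto; try (unfold a; lia).
    intros s s' Hs Hs'; simpl.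
    assert (Ha : 2 / d <= IZR a).
    { apply Rle_trans with (IZR (up (2 / d))); [lra|]. apply IZR_le; unfold a; lia. }
    assert (0 < 2 / d) by (apply Rdiv_lt_0_compat; lra).
    assert (B : forall s, 0 <= s <= 1 -> 0 <= / (IZR a + s) <= d / 2).
    { intros r Hr. split; [apply Rlt_le, Rinv_0_lt_compat; lra|].
      replace (d / 2) with (/ (2 / d)) by (field; lra).
      apply Rinv_le_contravar; lra. }
    pose proof (B s Hs); pose proof (B s' Hs').
    apply Rabs_le; lra.
  - destruct (harmonic_cover t ltac:(lra)) as (a & b & Ha & Hb & Hab & Hc).
    assert (Hg : forall c, exists k, node_gap ([c], 1%Z) * (4 / 5) ^ k <= d / 400).
    { intros c. set (g := node_gap ([c], 1%Z)).
      assert (0 <= g) by apply Rabs_pos.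
      destruct (pow_lt_1_zero (4 / 5) ltac:(rewrite Rabs_pos_eq; lra)
                 (d / 400 / (g + 1)) ltac:(apply Rdiv_lt_0_compat; lra)) as [k Hk].
      exists k. specialize (Hk k (le_n k)).
      pose proof (pow_lt (4/5) k ltac:(lra)).
      rewrite Rabs_pos_eq in Hk by lra.
      apply (Rmult_lt_compat_r (g + 1)) in Hk; [|lra].
      replace (d / 400 / (g + 1) * (g + 1)) with (d / 400) in Hk by (field; lra).
      nra. }
    destruct (Hg a) as [k1 Hk1], (Hg b) as [k2 Hk2].
    destruct (root_size a ltac:(lia)) as [La Ua].
    destruct (root_size b ltac:(lia)) as [Lb Ub].
    (* Each value is at least [node_hi] minus 100 gaps and at most [node_lo] plus 100 gaps, so gaps
       of [d / 400] put the sum within [d / 2] of [t]. *)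
    destruct (sum_of_gap_intervals _ node_lo node_hi node_gap (4 / 5) ltac:(lra)
      (node_over a) (node_over b) t (d / 400) (node_over_splits a) (node_over_splits b)
      ltac:(lra) (k1 + k2) ([a], 1%Z) ([b], 1%Z) k1 k2 ltac:(lia)
      (node_over_root a ltac:(lia)) (node_over_root b ltac:(lia)) Hk1 Hk2
      (root_gap a b Ha Hb ltac:(lia)) (root_gap b a Hb Ha ltac:(lia))
      ltac:(rewrite La, Ua, Lb, Ub; exact Hc))
      as (n1 & n2 & V1 & V2 & G1 & G2 & Hsum).
    pose proof V1 as ((U & EU & FU) & _). pose proof V2 as ((V & EV & FV) & _).
    exists a, b, U, V. repeat split; auto; try lia.
    intros s s' Hs Hs'. rewrite <- EU, <- EV.
    pose proof (node_over_diameter a n1 s V1 Hs).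
    pose proof (node_over_diameter b n2 s' V2 Hs').
    apply Rabs_le; lra.
Qed.

(** * Infinite continued fractions *)

Fixpoint cf_approx (e : nat -> Z) (n : nat) : R :=
  match n with
  | O => 0
  | S k => / (IZR (e O) + cf_approx (fun i => e (S i)) k)
  end.

Lemma cf_approx_range (n : nat) : forall e, (forall i, (1 <= e i)%Z) -> 0 <= cf_approx e n <= 1.
Proof.
  induction n as [|n IH]; intros e He; simpl; [lra|].
  specialize (IH (fun i => e (S i)) (fun i => He (S i))).
  pose proof (IZR_le _ _ (He O)).
  split; [apply Rlt_le, Rinv_0_lt_compat; lra|].
  rewrite <- Rinv_1; apply Rinv_le_contravar; lra.
Qed.

(* Two levels of the expansion contract by 4: [c (c' + s) + 1 >= 2]. *)
Lemma cf_approx_cauchy (n : nat) : forall e m, (forall i, (1 <= e i)%Z) -> (n <= m)%nat ->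
  Rabs (cf_approx e n - cf_approx e m) <= 2 * (1 / 2) ^ n.
Proof.
  induction n as [n IH] using lt_wf_ind; intros e m He Hm.
  destruct n as [|[|n]].
  - pose proof (cf_approx_range m e He); simpl. apply Rabs_le; lra.
  - pose proof (cf_approx_range m e He). pose proof (cf_approx_range 1 e He).
    simpl pow. apply Rabs_le; lra.
  - destruct m as [|[|m]]; try lia. cbn [cf_approx].
    assert (He2 : forall i, (1 <= e (S (S i)))%Z) by (intros; apply He).
    pose proof (cf_approx_range n _ He2). pose proof (cf_approx_range m _ He2).
    pose proof (IH n ltac:(lia) _ m He2 ltac:(lia)) as HI. cbv beta in *.
    set (s := cf_approx (fun i => e (S (S i))) n) in *.
    set (s' := cf_approx (fun i => e (S (S i))) m) in *.
    pose proof (IZR_le _ _ (He 0%nat)). pose proof (IZR_le _ _ (He 1%nat)).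
    set (c := IZR (e 0%nat)) in *. set (c' := IZR (e 1%nat)) in *.
    assert (2 <= c * (c' + s) + 1) by nra. assert (2 <= c * (c' + s') + 1) by nra.
    replace (/ (c + / (c' + s)) - / (c + / (c' + s')))
      with ((s - s') * / ((c * (c' + s) + 1) * (c * (c' + s') + 1)))
      by (field; repeat split; nra).
    rewrite Rabs_mult, (Rabs_pos_eq (/ _))
      by (apply Rlt_le, Rinv_0_lt_compat; nra).
    simpl pow. set (P := (1 / 2) ^ n) in *.
    replace (2 * (1 / 2 * (1 / 2 * P))) with ((2 * P) * / 4) by field.
    apply Rmult_le_compat; [apply Rabs_pos| |assumption|].
    + apply Rlt_le, Rinv_0_lt_compat; nra.
    + apply Rinv_le_contravar; nra.
Qed.

Definition cf_val (e : nat -> Z) : R := real (Lim_seq (cf_approx e)).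

Lemma cf_val_lim (e : nat -> Z) : (forall i, (1 <= e i)%Z) ->
  is_lim_seq (cf_approx e) (cf_val e).
Proof.
  intros He. apply Lim_seq_correct', ex_lim_seq_cauchy_corr.
  intros eps.
  destruct (pow_lt_1_zero (1 / 2) ltac:(rewrite Rabs_pos_eq; lra)
    (eps / 4) ltac:(destruct eps; simpl; lra)) as [N HN].
  exists N. intros n m Hn Hm.
  pose proof (cf_approx_cauchy N e n He Hn) as B1.
  pose proof (cf_approx_cauchy N e m He Hm) as B2.
  specialize (HN N (le_n N)). apply Rabs_lt_between in HN.
  apply Rabs_le_between in B1; apply Rabs_le_between in B2.
  apply Rabs_lt_between; lra.
Qed.

Lemma cf_val_range (e : nat -> Z) : (forall i, (1 <= e i)%Z) -> 0 <= cf_val e <= 1.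
Proof.
  intros He; pose proof (cf_val_lim e He) as HL. split.
  - apply (is_lim_seq_le (fun _ => 0) (cf_approx e) 0 (cf_val e));
      [|apply is_lim_seq_const|exact HL].
    intros n; apply cf_approx_range, He.
  - apply (is_lim_seq_le (cf_approx e) (fun _ => 1) (cf_val e) 1);
      [|exact HL|apply is_lim_seq_const].
    intros n; apply cf_approx_range, He.
Qed.

Lemma cf_val_step (e : nat -> Z) : (forall i, (1 <= e i)%Z) ->
  cf_val e = / (IZR (e O) + cf_val (fun i => e (S i))).
Proof.
  intros He.
  assert (He' : forall i, (1 <= e (S i))%Z) by auto.
  pose proof (IZR_le _ _ (He O)). pose proof (cf_val_range _ He').
  pose proof (cf_val_lim _ He) as L1. pose proof (cf_val_lim _ He') as L2.
  apply is_lim_seq_incr_1 in L1. cbn [cf_approx] in L1.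
  assert (L3 : is_lim_seq (fun n => / (IZR (e O) + cf_approx (fun i => e (S i)) n))
                 (/ (IZR (e O) + cf_val (fun i => e (S i))))).
  { apply (is_lim_seq_inv _ (Finite (IZR (e O) + cf_val (fun i => e (S i)))));
      [|intros E; inversion E; lra].
    apply is_lim_seq_plus'; [apply is_lim_seq_const|exact L2]. }
  apply is_lim_seq_unique in L1. apply is_lim_seq_unique in L3.
  rewrite L1 in L3. now inversion L3.
Qed.

(** Strictness comes from unfolding one more digit; it makes each digit the integer part of its
    complete quotient. *)
Lemma cf_val_pos (e : nat -> Z) : (forall i, (1 <= e i)%Z) -> 0 < cf_val e < 1.
Proof.
  intros He. rewrite cf_val_step by assumption.
  assert (He1 : forall i, (1 <= e (S i))%Z) by auto.
  assert (He2 : forall i, (1 <= e (S (S i)))%Z) by auto.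
  pose proof (IZR_le _ _ (He O)). pose proof (IZR_le _ _ (He1 O)).
  pose proof (cf_val_range _ He2).
  assert (0 < cf_val (fun i => e (S i))).
  { rewrite cf_val_step by assumption. apply Rinv_0_lt_compat; lra. }
  split; [apply Rinv_0_lt_compat; lra|].
  rewrite <- Rinv_1; apply Rinv_lt_contravar; lra.
Qed.

(* Descent on the denominator: if [cf_val e = P / D], the next tail has
   denominator [P < D]. *)
Lemma cf_val_not_fraction (D : nat) : forall e P, (forall i, (1 <= e i)%Z) ->
  (0 < D)%nat -> cf_val e * INR D <> IZR P.
Proof.
  induction D as [D IH] using lt_wf_ind; intros e P He HD E.
  assert (He1 : forall i, (1 <= e (S i))%Z) by auto.
  pose proof (cf_val_pos e He). pose proof (cf_val_pos _ He1).
  pose proof (IZR_le _ _ (He O)). apply lt_0_INR in HD.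
  assert (HP : (0 < P)%Z) by (apply lt_IZR; nra).
  assert (HPD : (P < Z.of_nat D)%Z) by (apply lt_IZR; rewrite <- INR_IZR_INZ; nra).
  (* If [cf_val e = P / D], the tail is [D / P - e O], whence the new numerator. *)
  apply (IH (Z.to_nat P) ltac:(lia) (fun i => e (S i)) (Z.of_nat D - e O * P)%Z He1);
    [lia|].
  rewrite INR_IZR_INZ, Z2Nat.id, minus_IZR, mult_IZR, <- INR_IZR_INZ by lia.
  rewrite <- E, (cf_val_step e He). field. lra.
Qed.

Lemma cf_val_irrational (e : nat -> Z) : (forall i, (1 <= e i)%Z) -> irrational (cf_val e).
Proof.
  intros He [[P D] E].
  apply (cf_val_not_fraction (Pos.to_nat D) e P He); [lia|].
  rewrite E, INR_IZR_INZ, positive_nat_Z. unfold Q2R; simpl. field.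
  apply not_0_IZR; lia.
Qed.

(* The expansion [0; e 0, e 1, ...]: the digit [e n] has index [S n]. *)
Lemma complete_quotient_cf_val (e : nat -> Z) (n : nat) : (forall i, (1 <= e i)%Z) ->
  complete_quotient (cf_val e) (S n) = IZR (e n) + cf_val (fun i => e (S (n + i))).
Proof.
  intros He. induction n as [|n IH].
  - simpl. replace (Int_part (cf_val e)) with 0%Z.
    + rewrite Rminus_0_r, (cf_val_step e He), Rinv_inv. reflexivity.
    + apply Int_part_spec. pose proof (cf_val_pos e He). lra.
  - set (k := S n) in *. cbn [complete_quotient]. rewrite IH.
    assert (Hn : forall i, (1 <= e (S (n + i)))%Z) by auto.
    pose proof (cf_val_pos _ Hn).
    rewrite <- (Int_part_spec _ (e n)) by lra.
    replace (_ + _ - _) with (cf_val (fun i => e (S (n + i)))) by ring.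
    rewrite (cf_val_step _ Hn), Rinv_inv, Nat.add_0_r. fold k.
    replace (fun i : nat => e (S (n + S i))) with (fun i : nat => e (S (k + i))); [reflexivity|].
    apply FunctionalExtensionality.functional_extensionality; intros i.
    f_equal; unfold k; lia.
Qed.

Lemma partial_quotient_cf_val (e : nat -> Z) (n : nat) : (forall i, (1 <= e i)%Z) ->
  partial_quotient (cf_val e) (S n) = e n.
Proof.
  intros He. unfold partial_quotient. rewrite complete_quotient_cf_val by assumption.
  symmetry; apply Int_part_spec.
  assert (Hn : forall i, (1 <= e (S (n + i)))%Z) by auto.
  pose proof (cf_val_pos _ Hn). lra.
Qed.

(** * Convergents and the sequence Q_n *)

Lemma irrational_Rinv_sub (x : R) (k : Z) : irrational x -> irrational (/ (x - IZR k)).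
Proof.
  intros Hx [r Hr].
  apply Hx. exists (/ r + inject_Z k)%Q.
  destruct (Req_dec (x - IZR k) 0) as [E|E].
  { exfalso; apply Hx. exists (inject_Z k). unfold Q2R; simpl. lra. }
  assert (Hr0 : ~ (r == 0)%Q).
  { intros H. apply Qeq_eqR in H. rewrite H in Hr.
    replace (Q2R 0) with 0 in Hr by (unfold Q2R; simpl; lra).
    now apply Rinv_neq_0_compat in E. }
  rewrite Q2R_plus, Q2R_inv, <- Hr, Rinv_inv by assumption.
  unfold Q2R; simpl. lra.
Qed.

Section Convergents.

Variable alpha : R.
Hypothesis alpha_irr : irrational alpha.

Local Notation cq := (complete_quotient alpha).
Local Notation pq := (partial_quotient alpha).
Local Notation num := (cf_num alpha).
Local Notation den := (cf_den alpha).
Local Notation star := (alpha_star alpha).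

Lemma complete_quotient_irrational (n : nat) : irrational (cq n).
Proof. induction n; simpl; [assumption|now apply irrational_Rinv_sub]. Qed.

Lemma complete_quotient_step (n : nat) :
  1 < cq (S n) /\ cq n = IZR (pq n) + / cq (S n).
Proof.
  pose proof (base_Int_part (cq n)) as [B1 B2].
  assert (cq n <> IZR (Int_part (cq n))).
  { intros E. apply (complete_quotient_irrational n).
    exists (inject_Z (Int_part (cq n))). unfold Q2R; simpl. lra. }
  cbn [complete_quotient]. unfold partial_quotient. split.
  - rewrite <- Rinv_1 at 1. apply Rinv_lt_contravar; lra.
  - rewrite Rinv_inv. lra.
Qed.

Lemma partial_quotient_ge1 (n : nat) : (1 <= pq (S n))%Z.
Proof.
  destruct (complete_quotient_step n) as [H _].
  pose proof (base_Int_part (cq (S n))) as [B1 B2].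
  assert (0 < pq (S n))%Z; [|lia].
  apply lt_IZR. unfold partial_quotient; lra.
Qed.

(** The conventions q_{-1} = 0 and p_{-1} = 1 make the recurrences hold from the first step on. *)
Definition cf_den_prev (n : nat) : Z := match n with O => 0 | S k => den k end.
Definition cf_num_prev (n : nat) : Z := match n with O => 1 | S k => num k end.

Lemma cf_den_step (n : nat) : den (S n) = (pq (S n) * den n + cf_den_prev n)%Z.
Proof. destruct n; [simpl; ring|reflexivity]. Qed.

Lemma cf_num_step (n : nat) : num (S n) = (pq (S n) * num n + cf_num_prev n)%Z.
Proof. destruct n; [simpl; ring|reflexivity]. Qed.

Lemma cf_den_pos (n : nat) : (1 <= den n)%Z /\ (0 <= cf_den_prev n <= den n)%Z.
Proof.
  induction n as [|n IH]; [simpl; lia|].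
  pose proof (partial_quotient_ge1 n). rewrite cf_den_step; cbn [cf_den_prev]. nia.
Qed.

Lemma alpha_star_eq (n : nat) : star n = IZR (cf_den_prev n) / IZR (den n).
Proof.
  induction n as [|n IH]; [simpl; field|].
  cbn [alpha_star]. rewrite IH, cf_den_step. cbn [cf_den_prev].
  destruct (cf_den_pos n) as [H1 H2]. pose proof (partial_quotient_ge1 n) as H3.
  destruct H2 as [H2 _].
  apply IZR_le in H1; apply IZR_le in H2; apply IZR_le in H3.
  rewrite plus_IZR, mult_IZR. field. split; nra.
Qed.

Lemma cf_det (n : nat) :
  (num n * cf_den_prev n - cf_num_prev n * den n = 1 \/
   num n * cf_den_prev n - cf_num_prev n * den n = -1)%Z.
Proof.
  induction n as [|n IH]; [simpl; lia|].
  rewrite cf_den_step, cf_num_step; cbn [cf_den_prev cf_num_prev]. lia.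
Qed.

(** Stated without division, so that the inductive step only multiplies by the next complete
    quotient. *)
Lemma alpha_moebius (n : nat) :
  alpha * (cq (S n) * IZR (den n) + IZR (cf_den_prev n)) =
  cq (S n) * IZR (num n) + IZR (cf_num_prev n).
Proof.
  induction n as [|n IH].
  - destruct (complete_quotient_step 0) as [H1 H2].
    assert (E : alpha = IZR (pq 0) + / cq 1) by exact H2.
    rewrite E at 1. cbn [cf_den cf_den_prev cf_num cf_num_prev]. field. lra.
  - destruct (complete_quotient_step (S n)) as [H1 H2].
    rewrite H2 in IH. rewrite cf_den_step, cf_num_step; cbn [cf_den_prev cf_num_prev].
    rewrite !plus_IZR, !mult_IZR.
    apply (f_equal (Rmult (cq (S (S n))))) in IH.
    set (X := cq (S (S n))) in *.
    assert (EX : X * / X = 1) by (apply Rinv_r; lra).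
    apply (Rplus_eq_reg_r 0).
    (* The added term vanishes because [X * / X = 1]; with it [ring] need not simplify the
       inverse. *)
    transitivity (X * (alpha * ((IZR (pq (S n)) + / X) * IZR (den n) + IZR (cf_den_prev n)))
       + (1 - X * / X) * alpha * IZR (den n)); [ring|].
    rewrite IH, EX.
    transitivity (X * (IZR (pq (S n)) * IZR (num n) + IZR (cf_num_prev n))
        + (X * / X) * IZR (num n)); [ring|]. rewrite EX. ring.
Qed.

(** * The approximation inequality at a single index *)

Definition good_index (n : nat) : Prop := 2 < cq (S n) + star n.

Lemma alpha_star_nonneg (n : nat) : 0 <= star n.
Proof.
  induction n as [|n IH]; simpl; [lra|].
  pose proof (IZR_le _ _ (partial_quotient_ge1 n)).
  apply Rlt_le, Rinv_0_lt_compat; lra.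
Qed.

(** Substituting the Moebius form of [alpha] leaves the determinant, which is 1 or -1, over q_n (X
    q_n + q_{n-1}). *)
Lemma convergent_error (n : nat) :
  Rabs (alpha - convergent alpha n) = / (IZR (den n) ^ 2 * (cq (S n) + star n)).
Proof.
  destruct (cf_den_pos n) as [H1 [H2 _]].
  destruct (complete_quotient_step n) as [H3 _].
  pose proof (alpha_moebius n) as HM.
  pose proof (cf_det n) as HD.
  apply IZR_le in H1; apply IZR_le in H2.
  unfold convergent. rewrite alpha_star_eq.
  set (q := IZR (den n)) in *. set (q' := IZR (cf_den_prev n)) in *.
  set (p := IZR (num n)) in *. set (p' := IZR (cf_num_prev n)) in *.
  set (X := cq (S n)) in *.
  assert (HD' : (p' * q - p * q') = 1 \/ (p' * q - p * q') = -1).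
  { unfold p, p', q, q'. rewrite <- !mult_IZR, <- minus_IZR.
    destruct HD as [HD|HD]; [right|left]; apply f_equal; lia. }
  assert (0 < X * q + q') by nra.
  assert (E : alpha = (X * p + p') / (X * q + q')) by (rewrite <- HM; field; lra).
  rewrite E.
  replace (_ - _) with ((p' * q - p * q') * / (q * (X * q + q'))) by (field; lra).
  replace (q ^ 2 * (X + q' / q)) with (q * (X * q + q')) by (field; lra).
  assert (0 < / (q * (X * q + q'))) by (apply Rinv_0_lt_compat; nra).
  rewrite Rabs_mult, (Rabs_pos_eq (/ _)) by lra.
  destruct HD' as [-> | ->]; [rewrite Rabs_R1|rewrite Rabs_left by lra]; lra.
Qed.

Lemma good_index_iff (n : nat) :
  Rabs (alpha - convergent alpha n) < 1 / (2 * IZR (den n) ^ 2) <-> good_index n.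
Proof.
  rewrite convergent_error. unfold good_index.
  destruct (cf_den_pos n) as [H1 _]. apply IZR_le in H1.
  destruct (complete_quotient_step n) as [H3 _].
  pose proof (alpha_star_nonneg n).
  assert (0 < IZR (den n) ^ 2) by (apply pow_lt; lra).
  set (Q := IZR (den n) ^ 2) in *. set (Y := cq (S n) + star n) in *.
  assert (0 < Y) by (unfold Y; lra).
  unfold Rdiv; rewrite Rmult_1_l. split; intros H'.
  - apply Rinv_lt_cancel in H'; nra.
  - apply Rinv_lt_contravar; [|nra]. apply Rmult_lt_0_compat; nra.
Qed.

Lemma cf_coprime (n : nat) : Z.gcd (num n) (den n) = 1%Z.
Proof.
  apply Zgcd_1_rel_prime, bezout_rel_prime.
  destruct (cf_det n) as [H|H].
  - apply Bezout_intro with (cf_den_prev n) (- cf_num_prev n)%Z; lia.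
  - apply Bezout_intro with (- cf_den_prev n)%Z (cf_num_prev n); lia.
Qed.

(** Two reduced fractions of equal value have the same denominator: Gauss's lemma gives divisibility
    both ways. *)
Lemma good_denominator_iff (q : Z) :
  good_denominator alpha q <-> exists n, q = den n /\ good_index n.
Proof.
  split.
  - intros (Hq & A & Hg & [n Hn] & Ha). exists n.
    destruct (cf_den_pos n) as [H1 _].
    assert (Eq : q = den n).
    { unfold convergent in Hn.
      assert (E : (A * den n = num n * q)%Z).
      { apply eq_IZR. rewrite !mult_IZR.
        pose proof (IZR_lt _ _ Hq). pose proof (IZR_le _ _ H1).
        apply (f_equal (fun x => x * IZR q * IZR (den n))) in Hn.
        field_simplify in Hn; lra. }
      apply Z.divide_antisym_nonneg; try lia.
      - apply Z.gauss with A; [exists (num n); lia|]. now rewrite Z.gcd_comm.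
      - apply Z.gauss with (num n); [exists A; lia|].
        rewrite Z.gcd_comm; apply cf_coprime. }
    split; [exact Eq|]. apply good_index_iff.
    rewrite Hn in Ha. now rewrite <- Eq.
  - intros (n & -> & Hn). destruct (cf_den_pos n) as [H1 _].
    split; [lia|]. exists (num n). split; [apply cf_coprime|].
    split; [now exists n|]. now apply good_index_iff.
Qed.

(** Failure at [n] forces the digit 1 and x + y <= 1 with x = [star n] and y = 1 / [cq (n + 2)]. The
    next sum is (1 + x + y) / (y (1 + x)), and 1 + x + y - 2 y (1 + x) >= 2 x^2. *)
Lemma good_index_next (n : nat) : ~ good_index n -> good_index (S n).
Proof.
  unfold good_index; intros H; apply Rnot_lt_le in H.
  destruct (complete_quotient_step n) as [H1 _].
  destruct (complete_quotient_step (S n)) as [H2 H3].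
  pose proof (alpha_star_nonneg n).
  pose proof (IZR_le _ _ (partial_quotient_ge1 n)).
  set (X := cq (S (S n))) in *.
  assert (0 < / X < 1)
    by (split; [apply Rinv_0_lt_compat|rewrite <- Rinv_1; apply Rinv_lt_contravar]; lra).
  assert (E : pq (S n) = 1%Z).
  { assert (pq (S n) < 2)%Z by (apply lt_IZR; lra).
    pose proof (partial_quotient_ge1 n). lia. }
  cbn [alpha_star]. rewrite E in *.
  replace X with (/ / X) by apply Rinv_inv.
  set (y := / X) in *. set (x := star n) in *.
  replace (/ y + / (1 + x)) with ((1 + x + y) / (y * (1 + x))) by (field; lra).
  apply (Rmult_lt_reg_r (y * (1 + x))); [nra|].
  replace ((1 + x + y) / (y * (1 + x)) * (y * (1 + x))) with (1 + x + y) by (field; nra).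
  (* For [x = 0] the bound [2 * x ^ 2] is not strict, and [y < 1] is used instead. *)
  destruct (Req_dec x 0) as [Ex|Ex]; [rewrite Ex; lra|].
  assert (0 < x) by lra. nra.
Qed.

(** * Enumeration of the good denominators *)

Hypothesis first_ge2 : (2 <= pq 1)%Z.

(** A first digit at least 2 separates q_0 from q_1; afterwards q_{n-1} >= 1 gives the strict
    increase. *)
Lemma cf_den_lt_succ (n : nat) : (den n < den (S n))%Z.
Proof.
  rewrite cf_den_step. destruct (cf_den_pos n) as [H1 H2].
  pose proof (partial_quotient_ge1 n).
  destruct n as [|n]; [simpl; lia|].
  cbn [cf_den_prev] in *. destruct (cf_den_pos n). nia.
Qed.

Lemma cf_den_lt (i j : nat) : (i < j)%nat -> (den i < den j)%Z.
Proof.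
  induction 1 as [|j Hj IH]; [apply cf_den_lt_succ|].
  pose proof (cf_den_lt_succ j). lia.
Qed.

Lemma cf_den_le (i j : nat) : (i <= j)%nat -> (den i <= den j)%Z.
Proof. intros H. destruct (Nat.eq_dec i j) as [->|]; [lia|]. apply Z.lt_le_incl, cf_den_lt; lia. Qed.

Lemma cf_den_inj (i j : nat) : den i = den j -> i = j.
Proof.
  intros E. destruct (lt_eq_lt_dec i j) as [[H|H]|H]; auto; apply cf_den_lt in H; lia.
Qed.

Lemma cf_den_ge (n : nat) : (Z.of_nat n < den n)%Z.
Proof. induction n as [|n IH]; [simpl; lia|]. pose proof (cf_den_lt_succ n). lia. Qed.

Lemma alpha_star_lt1 (n : nat) : star n < 1.
Proof.
  rewrite alpha_star_eq. destruct (cf_den_pos n) as [H1 _].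
  assert (H : (cf_den_prev n < den n)%Z) by (destruct n; [simpl; lia|apply cf_den_lt_succ]).
  apply IZR_le in H1; apply IZR_lt in H.
  apply (Rmult_lt_reg_r (IZR (den n))); [lra|].
  replace (_ / _ * _) with (IZR (cf_den_prev n)) by (field; lra). lra.
Qed.

Lemma good_index_0 : good_index 0.
Proof.
  unfold good_index; cbn [alpha_star].
  destruct (complete_quotient_step 1) as [H1 H2].
  pose proof (IZR_le _ _ first_ge2).
  assert (0 < / cq 2) by (apply Rinv_0_lt_compat; lra). lra.
Qed.

(** Steps of one or two suffice, as two neighbouring indices never both fail. *)
Fixpoint good_enum (n : nat) : nat :=
  match n with
  | O => O
  | S k => if excluded_middle_informative (good_index (S (good_enum k)))
           then S (good_enum k) else S (S (good_enum k))
  end.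

Lemma good_enum_good (n : nat) : good_index (good_enum n).
Proof.
  destruct n as [|n]; simpl; [apply good_index_0|].
  destruct excluded_middle_informative; [assumption|now apply good_index_next].
Qed.

Lemma good_enum_onto (m : nat) : good_index m -> exists n, good_enum n = m.
Proof.
  induction m as [m IH] using lt_wf_ind; intros Hm.
  destruct m as [|m]; [now exists O|].
  destruct (excluded_middle_informative (good_index m)) as [H|H].
  - destruct (IH m ltac:(lia) H) as [n Hn]. exists (S n); simpl. rewrite Hn.
    now destruct excluded_middle_informative.
  - destruct m as [|m]; [now pose proof good_index_0|].
    destruct (excluded_middle_informative (good_index m)) as [H'|H'].
    + destruct (IH m ltac:(lia) H') as [n Hn]. exists (S n); simpl. rewrite Hn.
      now destruct excluded_middle_informative.
    + now apply good_index_next in H'.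
Qed.

(** The choice operator needs a witness, which [good_enum] supplies; from here on only this property
    of [Qseq] is used. *)
Lemma Qseq_enumerates : increasing_enumeration (good_denominator alpha) (Qseq alpha).
Proof.
  unfold Qseq. apply epsilon_spec. exists (fun n => den (good_enum n)). split.
  - intros n. rewrite Nat.add_1_r. apply cf_den_lt; simpl.
    destruct excluded_middle_informative; lia.
  - intros q. rewrite good_denominator_iff. split.
    + intros (m & -> & Hm). destruct (good_enum_onto m Hm) as [n <-]. now exists n.
    + intros [n <-]. exists (good_enum n). split; [reflexivity|apply good_enum_good].
Qed.

Lemma Qseq_lt (i j : nat) : (i < j)%nat -> (Qseq alpha i < Qseq alpha j)%Z.
Proof.
  destruct Qseq_enumerates as [H _].
  induction 1 as [|j Hj IH]; [rewrite <- Nat.add_1_r; apply H|].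
  specialize (H j). rewrite Nat.add_1_r in H. lia.
Qed.

Lemma Qseq_good (n : nat) : exists m, Qseq alpha n = den m /\ good_index m.
Proof. apply good_denominator_iff. apply Qseq_enumerates. now exists n. Qed.

Lemma Qseq_ge (n : nat) : (Z.of_nat n < Qseq alpha n)%Z.
Proof.
  induction n as [|n IH].
  - destruct (Qseq_good 0) as (m & -> & _). destruct (cf_den_pos m). lia.
  - pose proof (Qseq_lt n (S n) ltac:(lia)). lia.
Qed.

(** [den m'] occurs after position [n], so the next term is at most [den m']. Its index then lies in
    (m, m'], where only [m'] is good. *)
Lemma Qseq_succ (n m m' : nat) : Qseq alpha n = den m -> (m < m')%nat ->
  good_index m' -> (forall k, (m < k < m')%nat -> ~ good_index k) ->
  Qseq alpha (n + 1) = den m'.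
Proof.
  intros E Hlt Hg Hno.
  assert (Hex : exists i, Qseq alpha i = den m').
  { apply Qseq_enumerates, good_denominator_iff. now exists m'. }
  destruct Hex as [i Hi].
  destruct (Qseq_good (n + 1)) as (k & Hk & Gk).
  assert (n < i)%nat.
  { destruct (le_lt_dec i n) as [L|L]; [|exact L].
    assert (Qseq alpha i <= Qseq alpha n)%Z
      by (destruct (Nat.eq_dec i n) as [->|]; [lia|apply Z.lt_le_incl, Qseq_lt; lia]).
    pose proof (cf_den_lt _ _ Hlt). lia. }
  assert (L1 : (Qseq alpha (n + 1) <= Qseq alpha i)%Z).
  { destruct (Nat.eq_dec (n + 1) i) as [->|]; [lia|apply Z.lt_le_incl, Qseq_lt; lia]. }
  pose proof (Qseq_lt n (n + 1) ltac:(lia)) as L2.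
  rewrite Hk in *. f_equal.
  assert (m < k)%nat by (destruct (le_lt_dec k m) as [L|L]; [apply cf_den_le in L; lia|lia]).
  assert (k <= m')%nat by (destruct (le_lt_dec k m') as [L|L]; [lia|apply cf_den_lt in L; lia]).
  destruct (Nat.eq_dec k m'); [assumption|]. exfalso; apply (Hno k); [lia|assumption].
Qed.

Lemma pair_exists (n : nat) :
  exists nu, consecutive_pair alpha n nu \/ skip_pair alpha n nu.
Proof.
  destruct (Qseq_good n) as (m & Hm & Gm).
  destruct (excluded_middle_informative (good_index (m + 1))) as [H|H].
  - exists m. left. split; [assumption|]. apply (Qseq_succ n m); auto; lia.
  - exists (m + 1)%nat. right. split; [lia|].
    replace (m + 1 - 1)%nat with m by lia. split; [assumption|].
    apply (Qseq_succ n m); auto; [lia| |].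
    + rewrite (Nat.add_1_r (m + 1)). now apply good_index_next.
    + intros k Hk. now replace k with (m + 1)%nat by lia.
Qed.

Lemma m_seq_cases (n : nat) :
  exists nu, (consecutive_pair alpha n nu /\
      m_seq alpha n = F (star (nu + 1)) (/ cq (nu + 2))) \/
    (skip_pair alpha n nu /\ m_seq alpha n = G (star nu) (/ cq (nu + 2))).
Proof.
  unfold m_seq. destruct excluded_middle_informative as [H|H].
  - exists (epsilon (inhabits 0%nat) (consecutive_pair alpha n)). left.
    split; [now apply epsilon_spec|reflexivity].
  - exists (epsilon (inhabits 0%nat) (skip_pair alpha n)). right.
    split; [|reflexivity]. apply epsilon_spec.
    destruct (pair_exists n) as [nu [Hc|Hs]]; [exfalso; eauto|eauto].
Qed.

Lemma m_seq_skip (nu : nat) : (1 <= nu)%nat -> good_index (nu - 1) -> ~ good_index nu ->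
  exists n, skip_pair alpha n nu /\ m_seq alpha n = G (star nu) (/ cq (nu + 2)).
Proof.
  intros Hnu Hg Hb.
  assert (Hex : exists n, Qseq alpha n = den (nu - 1)).
  { apply Qseq_enumerates, good_denominator_iff. eauto. }
  destruct Hex as [n Hn]. exists n.
  assert (Hs : skip_pair alpha n nu).
  { split; [lia|]. split; [assumption|].
    apply (Qseq_succ n (nu - 1)); auto; [lia| |].
    - rewrite Nat.add_1_r. now apply good_index_next.
    - intros k Hk. now replace k with nu by lia. }
  split; [assumption|].
  destruct Hs as (_ & _ & Hs).
  (* A consecutive pair would give k = nu - 1 and k + 1 = nu + 1 by injectivity of the
     denominators. *)
  destruct (m_seq_cases n) as [k [[[K1 K2] _]|[(K0 & K1 & K2) K3]]].
  - rewrite Hn in K1; rewrite Hs in K2. apply cf_den_inj in K1, K2. lia.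
  - rewrite Hs in K2. apply cf_den_inj in K2. replace k with nu in K3 by lia. exact K3.
Qed.

End Convergents.

(** * Concatenation of blocks *)

Lemma alpha_star_cfv (alpha : R) (L : list Z) : forall n, (length L <= n)%nat ->
  (forall i, (i < length L)%nat -> partial_quotient alpha (n - i) = nth i L 2%Z) ->
  alpha_star alpha n = cfv L (alpha_star alpha (n - length L)).
Proof.
  induction L as [|c L IH]; intros n Hn H; simpl in *; [now rewrite Nat.sub_0_r|].
  destruct n as [|n]; [lia|]. cbn [alpha_star].
  pose proof (H 0%nat ltac:(lia)) as H0. rewrite Nat.sub_0_r in H0. rewrite H0.
  rewrite (IH n); [reflexivity|lia|].
  intros i Hi. apply (H (S i)). lia.
Qed.

Lemma complete_quotient_cfv (alpha : R) (L : list Z) : irrational alpha ->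
  forall n, (forall i, (i < length L)%nat -> partial_quotient alpha (n + i) = nth i L 2%Z) ->
  / complete_quotient alpha n = cfv L (/ complete_quotient alpha (n + length L)).
Proof.
  intros Ha. induction L as [|c L IH]; intros n H; simpl in *; [now rewrite Nat.add_0_r|].
  destruct (complete_quotient_step alpha Ha n) as [_ E].
  pose proof (H 0%nat ltac:(lia)) as H0. rewrite Nat.add_0_r in H0.
  rewrite E, H0, (IH (S n)).
  - now rewrite Nat.add_succ_r.
  - intros i Hi. rewrite <- (H (S i)) by lia. f_equal; lia.
Qed.

Section Blocks.

Variables (a b : nat -> Z) (U V : nat -> list Z).
Hypothesis a_big : forall k, (6 <= a k)%Z.
Hypothesis b_big : forall k, (6 <= b k)%Z.
Hypothesis U_digits : forall k, Forall digit (U k).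
Hypothesis V_digits : forall k, Forall digit (V k).

(** [U k] is reversed because it is read leftwards from [a k]. The outer digits 2 keep [b k] at
    least three places before the next [a], and give the whole expansion a first digit 2. *)
Definition block (k : nat) : list Z :=
  2%Z :: rev (U k) ++ a k :: 1%Z :: b k :: V k ++ [2%Z].

Fixpoint prefix (k : nat) : list Z :=
  match k with O => [] | S j => prefix j ++ block j end.

(* The default value of [nth] is never reached: [prefix (S i)] is longer than [i]. *)
Definition digit_seq (i : nat) : Z := nth i (prefix (S i)) 2%Z.

(** The position of [a k] in [digit_seq]; as a partial quotient [a k] has the index
    [S (center k)]. *)
Definition center (k : nat) : nat := length (prefix k) + S (length (U k)).

Lemma block_length (k : nat) : length (block k) = (length (U k) + length (V k) + 5)%nat.
Proof.
  unfold block; simpl. rewrite length_app, length_rev; simpl. rewrite length_app; simpl. lia.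
Qed.

Lemma prefix_length (k : nat) : (k <= length (prefix k))%nat.
Proof. induction k; simpl; [lia|]. rewrite length_app, block_length. lia. Qed.

Lemma prefix_le (j k : nat) : (j <= k)%nat -> exists L, prefix k = prefix j ++ L.
Proof.
  induction 1 as [|k Hk [L IH]]; [exists []; now rewrite app_nil_r|].
  exists (L ++ block k). simpl. now rewrite IH, app_assoc.
Qed.

Lemma digit_seq_nth (i k : nat) : (i < length (prefix k))%nat ->
  digit_seq i = nth i (prefix k) 2%Z.
Proof.
  intros Hi. unfold digit_seq. pose proof (prefix_length (S i)).
  destruct (le_lt_dec (S i) k) as [L|L].
  - destruct (prefix_le _ _ L) as [M ->]. rewrite app_nth1; [reflexivity|lia].
  - destruct (prefix_le k (S i) ltac:(lia)) as [M ->]. now rewrite app_nth1.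
Qed.

Lemma digit_seq_block (k r : nat) : (r < length (block k))%nat ->
  digit_seq (length (prefix k) + r) = nth r (block k) 2%Z.
Proof.
  intros Hr. rewrite (digit_seq_nth _ (S k)).
  - cbn [prefix]. rewrite app_nth2 by lia.
    now replace (length (prefix k) + r - length (prefix k))%nat with r by lia.
  - cbn [prefix]. rewrite length_app. lia.
Qed.

Lemma digit_seq_left (k i : nat) : (i < length (a k :: U k))%nat ->
  digit_seq (center k - i) = nth i (a k :: U k) 2%Z.
Proof.
  simpl length; intros Hi. unfold center.
  replace (length (prefix k) + S (length (U k)) - i)%nat
    with (length (prefix k) + S (length (U k) - i))%nat by lia.
  rewrite digit_seq_block by (rewrite block_length; lia).
  unfold block. cbn [nth].
  replace (rev (U k) ++ a k :: 1%Z :: b k :: V k ++ [2%Z])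
    with (rev (a k :: U k) ++ 1%Z :: b k :: V k ++ [2%Z])
    by (simpl; now rewrite <- app_assoc).
  rewrite app_nth1 by (rewrite length_rev; simpl; lia).
  rewrite rev_nth by (simpl; lia).
  now replace (length (a k :: U k) - S (length (U k) - i))%nat with i by (simpl; lia).
Qed.

Lemma digit_seq_right (k i : nat) : (i < length (1%Z :: b k :: V k))%nat ->
  digit_seq (center k + 1 + i) = nth i (1%Z :: b k :: V k) 2%Z.
Proof.
  simpl length; intros Hi. unfold center.
  replace (length (prefix k) + S (length (U k)) + 1 + i)%nat
    with (length (prefix k) + S (S (length (U k) + i)))%nat by lia.
  rewrite digit_seq_block by (rewrite block_length; lia).
  unfold block. cbn [nth]. rewrite app_nth2 by (rewrite length_rev; lia).
  rewrite length_rev. replace (S (length (U k) + i) - length (U k))%nat with (S i) by lia.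
  change (nth i ((1%Z :: b k :: V k) ++ [2%Z]) 2%Z = nth i (1%Z :: b k :: V k) 2%Z).
  now rewrite app_nth1 by (simpl; lia).
Qed.

Lemma block_nth (k r : nat) : (r < length (block k))%nat ->
  digit (nth r (block k) 2%Z) \/ r = S (length (U k)) \/ r = S (S (S (length (U k)))).
Proof.
  intros Hr. rewrite block_length in Hr. unfold block.
  destruct r as [|r]; [left; simpl; unfold digit; lia|]. cbn [nth].
  destruct (lt_dec r (length (U k))) as [L|L].
  - left. rewrite app_nth1 by (rewrite length_rev; lia).
    apply (proj1 (Forall_forall _ _) (U_digits k)), in_rev, nth_In.
    now rewrite length_rev.
  - rewrite app_nth2 by (rewrite length_rev; lia). rewrite length_rev.
    remember (r - length (U k))%nat as i eqn:Ei.
    destruct i as [|[|[|i]]]; [right; left; lia|left; simpl; unfold digit; lia|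
      right; right; lia|]. cbn [nth]. left.
    destruct (lt_dec i (length (V k))) as [L'|L'].
    + rewrite app_nth1 by lia. apply (proj1 (Forall_forall _ _) (V_digits k)), nth_In, L'.
    + rewrite app_nth2 by lia. replace (i - length (V k))%nat with 0%nat by lia.
      simpl; unfold digit; lia.
Qed.

Lemma digit_seq_cases (i : nat) :
  digit (digit_seq i) \/ exists k, i = center k \/ i = (center k + 2)%nat.
Proof.
  assert (H : forall k, (i < length (prefix k))%nat ->
    exists j r, i = (length (prefix j) + r)%nat /\ (r < length (block j))%nat).
  { induction k as [|k IH]; [simpl; lia|]. cbn [prefix]. rewrite length_app. intros Hi.
    destruct (lt_dec i (length (prefix k))) as [L|L]; [auto|].
    exists k, (i - length (prefix k))%nat. lia. }
  destruct (H (S i) (prefix_length (S i))) as (k & r & -> & Hr).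
  rewrite digit_seq_block by assumption.
  destruct (block_nth k r Hr) as [D|[D|D]]; [left; exact D| |];
    right; exists k; unfold center; lia.
Qed.

Lemma center_lt (i j : nat) : (i < j)%nat -> (center i + 5 <= center j)%nat.
Proof.
  assert (S1 : forall k, (center k + 5 <= center (S k))%nat).
  { intros k. unfold center. simpl. rewrite length_app, block_length. lia. }
  induction 1 as [|j Hj IH]; [apply S1|]. specialize (S1 j). lia.
Qed.

(** For consecutive pairs: large digits are two places apart within a block and at least three
    across blocks. *)
Lemma digit_seq_adjacent (i : nat) : digit (digit_seq i) \/ digit (digit_seq (S i)).
Proof.
  destruct (digit_seq_cases i) as [D|[k Hk]]; [now left|].
  destruct (digit_seq_cases (S i)) as [D|[l Hl]]; [now right|].
  exfalso. destruct (lt_eq_lt_dec k l) as [[H| ->]|H]; try apply center_lt in H; lia.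
Qed.

(** For skipped indices: large digits two places apart can only be [a k] and [b k] of one block. *)
Lemma digit_seq_alternate (i : nat) :
  digit (digit_seq i) \/ digit (digit_seq (S (S i))) \/ exists k, i = center k.
Proof.
  destruct (digit_seq_cases i) as [D|[k Hk]]; [now left|].
  destruct (digit_seq_cases (S (S i))) as [D|[l Hl]]; [now right; left|].
  right; right. destruct (lt_eq_lt_dec k l) as [[H| ->]|H]; try apply center_lt in H;
    exists l; lia.
Qed.

Lemma digit_seq_ge1 (i : nat) : (1 <= digit_seq i)%Z.
Proof.
  destruct (digit_seq_cases i) as [D|[k [-> | ->]]]; [unfold digit in D; lia| |].
  - pose proof (digit_seq_left k 0 ltac:(simpl; lia)) as E.
    rewrite Nat.sub_0_r in E. rewrite E; simpl. specialize (a_big k). lia.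
  - pose proof (digit_seq_right k 1 ltac:(simpl; lia)) as E.
    replace (center k + 2)%nat with (center k + 1 + 1)%nat by lia.
    rewrite E; simpl. specialize (b_big k). lia.
Qed.

Definition alpha_blocks : R := cf_val digit_seq.

Local Notation al := alpha_blocks.

Lemma alpha_blocks_irrational : irrational al.
Proof. apply cf_val_irrational, digit_seq_ge1. Qed.

Lemma alpha_blocks_digit (n : nat) : partial_quotient al (S n) = digit_seq n.
Proof. apply partial_quotient_cf_val, digit_seq_ge1. Qed.

Lemma alpha_blocks_first : (2 <= partial_quotient al 1)%Z.
Proof. rewrite alpha_blocks_digit. change (2 <= 2)%Z. lia. Qed.

Lemma alpha_blocks_center (k : nat) : exists s s', 0 <= s <= 1 /\ 0 <= s' <= 1 /\
  alpha_star al (S (center k)) = cfv (a k :: U k) s /\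
  / complete_quotient al (S (center k) + 2) = cfv (b k :: V k) s'.
Proof.
  pose proof alpha_blocks_irrational as Ha. pose proof alpha_blocks_first as H1.
  eexists; eexists.
  split; [|split; [|split]].
  (* The two equations are solved first, since they determine the tails [s] and [s']. *)
  3: { apply alpha_star_cfv; [unfold center; simpl; lia|].
    intros i Hi. replace (S (center k) - i)%nat with (S (center k - i))
      by (simpl in Hi; unfold center; lia).
    rewrite alpha_blocks_digit. now apply digit_seq_left. }
  3: { apply complete_quotient_cfv; [exact Ha|].
    intros i Hi. replace (S (center k) + 2 + i)%nat with (S (center k + 1 + S i)) by lia.
    rewrite alpha_blocks_digit. apply (digit_seq_right k (S i)). simpl in *; lia. }
  - pose proof (alpha_star_nonneg al Ha). split; [auto|].
    apply Rlt_le, alpha_star_lt1; assumption.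
  - match goal with |- context [complete_quotient al ?n] =>
      replace n with (S (center k + 2 + length (b k :: V k))) by (simpl; lia);
      destruct (complete_quotient_step al Ha (center k + 2 + length (b k :: V k))) as [H _]
    end.
    split; [apply Rlt_le, Rinv_0_lt_compat; lra|].
    rewrite <- Rinv_1; apply Rinv_le_contravar; lra.
Qed.

End Blocks.

(** As 25/96 = (1 + 1/24) / 4, the claim is 4 F - 1 >= 1/24, cleared of denominators. The threshold
    1/6 is what a leading digit at most 5 ensures. *)
Lemma F_lower (x y : R) : 0 <= x < 1 -> 0 <= y < 1 -> 1 / 6 <= x \/ 1 / 6 <= y ->
  25 / 96 <= F x y.
Proof.
  assert (H : forall x y, 0 <= x < 1 -> 0 <= y < 1 -> 1 / 6 <= x ->
    (1 + x * y) * (1 - x) * (1 - y) <= 24 * (x * (1 - y) ^ 2 + y * (1 - x) ^ 2)).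
  { clear x y; intros x y Hx Hy H6.
    assert (P : 0 <= (1 - x) * (1 - y)) by (apply Rmult_le_pos; lra).
    assert (Q : x * y <= 1) by nra.
    assert (B : (1 + x * y) * (1 - x) * (1 - y) <= 2 * ((1 - x) * (1 - y))) by nra.
    apply Rle_trans with (1 := B).
    assert (0 <= y * (1 - x) ^ 2) by (apply Rmult_le_pos; [lra|apply pow2_ge_0]).
    (* Since 24 x >= 4, the first term suffices while 1 - y >= 1/2. Otherwise both terms have
       coefficient at least 4, and 4 u^2 + 4 v^2 >= 8 u v with u = 1 - x, v = 1 - y. *)
    destruct (Rle_dec y (1 / 2)) as [C|C].
    - assert (4 * (1 - y) ^ 2 <= 24 * (x * (1 - y) ^ 2))
        by (pose proof (pow2_ge_0 (1 - y)); nra).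
      nra.
    - assert (4 * (1 - y) ^ 2 <= 24 * (x * (1 - y) ^ 2))
        by (pose proof (pow2_ge_0 (1 - y)); nra).
      assert (4 * (1 - x) ^ 2 <= 24 * (y * (1 - x) ^ 2))
        by (pose proof (pow2_ge_0 (1 - x)); nra).
      pose proof (pow2_ge_0 (x - y)). nra. }
  intros Hx Hy Hor.
  assert (K : (1 + x * y) * (1 - x) * (1 - y) <= 24 * (x * (1 - y) ^ 2 + y * (1 - x) ^ 2)).
  { destruct Hor as [C|C]; [now apply H|].
    pose proof (H y x Hy Hx C). lra. }
  unfold F. apply Rdiv_le_cross; [lra| |].
  - repeat apply Rmult_lt_0_compat; nra.
  - (* (1 - xy)^2 - (1 + xy)(1 - x)(1 - y) = x (1 - y)^2 + y (1 - x)^2 *)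
    nra.
Qed.

Theorem mainTheorem1 :
  exists omega0 : R,
    1 / 4 < omega0 /\
    forall m : R, 1 / 4 <= m <= omega0 -> spectrum_I m.
Proof.
  (* This is (1 + t) / 4 at the largest admissible target t = 1/24. *)
  exists (25 / 96). split; [lra|]. intros m Hm.
  assert (Hblock : forall k : nat, exists B : Z * Z * list Z * list Z,
    let '(a, b, U, V) := B in
    (6 <= a)%Z /\ (6 <= b)%Z /\ Forall digit U /\ Forall digit V /\
    forall s s', 0 <= s <= 1 -> 0 <= s' <= 1 ->
      Rabs (cfv (a :: U) s + cfv (b :: V) s' - (4 * m - 1)) <= / INR (S k)).
  { intros k.
    destruct (small_sum_approximation (4 * m - 1) (/ INR (S k)))
      as (a & b & U & V & H); [lra|apply Rinv_0_lt_compat, lt_0_INR; lia|].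
    now exists (a, b, U, V). }
  pose (B := fun k => proj1_sig (constructive_indefinite_description _ (Hblock k))).
  pose proof (fun k => proj2_sig (constructive_indefinite_description _ (Hblock k))) as HB.
  change (forall k, let '(a, b, U, V) := B k in
    (6 <= a)%Z /\ (6 <= b)%Z /\ Forall digit U /\ Forall digit V /\
    forall s s', 0 <= s <= 1 -> 0 <= s' <= 1 ->
      Rabs (cfv (a :: U) s + cfv (b :: V) s' - (4 * m - 1)) <= / INR (S k)) in HB.
  clearbody B.
  pose (a := fun k => fst (fst (fst (B k)))). pose (b := fun k => snd (fst (fst (B k)))).
  pose (U := fun k => snd (fst (B k))). pose (V := fun k => snd (B k)).
  assert (HB' : forall k, (6 <= a k)%Z /\ (6 <= b k)%Z /\ Forall digit (U k) /\
    Forall digit (V k) /\ forall s s', 0 <= s <= 1 -> 0 <= s' <= 1 ->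
      Rabs (cfv (a k :: U k) s + cfv (b k :: V k) s' - (4 * m - 1)) <= / INR (S k)).
  { intros k. specialize (HB k). unfold a, b, U, V.
    destruct (B k) as [[[a' b'] U'] V']. exact HB. }
  assert (Ka : forall k, (6 <= a k)%Z) by apply HB'.
  assert (Kb : forall k, (6 <= b k)%Z) by (intros; apply HB').
  assert (KU : forall k, Forall digit (U k)) by (intros; apply HB').
  assert (KV : forall k, Forall digit (V k)) by (intros; apply HB').
  assert (Kap : forall k s s', 0 <= s <= 1 -> 0 <= s' <= 1 ->
      Rabs (cfv (a k :: U k) s + cfv (b k :: V k) s' - (4 * m - 1)) <= / INR (S k))
    by (intros k; apply HB').
  clear HB HB'.
  set (al := alpha_blocks a b U V).
  assert (Irr : irrational al) by now apply alpha_blocks_irrational.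
  assert (Hd : forall n, partial_quotient al (S n) = digit_seq a b U V n)
    by (intros; now apply alpha_blocks_digit).
  assert (H1 : (2 <= partial_quotient al 1)%Z) by now apply alpha_blocks_first.
  set (c := center a b U V).
  assert (HG : forall k,
    Rabs (G (alpha_star al (S (c k))) (/ complete_quotient al (S (c k) + 2)) - m)
      <= / INR (S k)).
  { intros k.
    destruct (alpha_blocks_center a b U V Ka Kb KU KV k) as (s & s' & Hs & Hs' & E1 & E2).
    fold al c in E1, E2. rewrite E1, E2. unfold G.
    pose proof (Kap k s s' Hs Hs') as K. apply Rabs_le_between in K.
    assert (0 < / INR (S k)) by (apply Rinv_0_lt_compat, lt_0_INR; lia).
    apply Rabs_le; lra. }
  assert (star_ge : forall n, digit (partial_quotient al (S n)) ->
    1 / 6 <= alpha_star al (S n)).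
  { intros n [_ D]; apply IZR_le in D. cbn [alpha_star].
    pose proof (alpha_star_nonneg al Irr n). pose proof (alpha_star_lt1 al Irr H1 n).
    pose proof (IZR_le _ _ (partial_quotient_ge1 al Irr n)).
    replace (1 / 6) with (/ 6) by lra. apply Rinv_le_contravar; lra. }
  assert (cq_ge : forall n, digit (partial_quotient al (S n)) ->
    1 / 6 <= / complete_quotient al (S n)).
  { intros n [_ D]; apply IZR_le in D.
    destruct (complete_quotient_step al Irr n) as [L _].
    pose proof (base_Int_part (complete_quotient al (S n))) as [_ L'].
    unfold partial_quotient in D.
    replace (1 / 6) with (/ 6) by lra. apply Rinv_le_contravar; lra. }
  assert (cq_range : forall n, 0 <= / complete_quotient al (S n) < 1).
  { intros n. destruct (complete_quotient_step al Irr n) as [L _].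
    split; [apply Rlt_le, Rinv_0_lt_compat; lra|].
    rewrite <- Rinv_1; apply Rinv_lt_contravar; lra. }
  assert (star_range : forall n, 0 <= alpha_star al n < 1)
    by (intros; split; [now apply alpha_star_nonneg|now apply alpha_star_lt1]).
  assert (c_ge : forall k, (k <= c k)%nat).
  { induction k as [|k IH]; [lia|].
    pose proof (center_lt a b U V k (S k) ltac:(lia)) as HC. fold c in HC; lia. }
  exists al. split; [exact Irr|].
  apply is_LimInf_seq_unique. intros eps.
  destruct (archimed_cor1 eps ltac:(destruct eps; assumption)) as (K & HK & HK0).
  assert (Kinv : forall k, (K <= k)%nat -> / INR (S k) < eps).
  { intros k Hk. apply Rle_lt_trans with (2 := HK).
    apply Rinv_le_contravar; [now apply lt_0_INR|apply le_INR; lia]. }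
  split.
  - intros N.
    (* The pattern [k] is met at some [n] with Q_n = q_{c k} > c k >= k >= Q_N, which rules out n <
       N. *)
    pose (k := Nat.max K (Z.to_nat (Qseq al N))).
    assert (Dc : partial_quotient al (S (c k)) = a k).
    { rewrite Hd. pose proof (digit_seq_left a b U V k 0 ltac:(simpl; lia)) as E.
      now rewrite Nat.sub_0_r in E. }
    assert (D1 : partial_quotient al (S (S (c k))) = 1%Z).
    { rewrite Hd. pose proof (digit_seq_right a b U V k 0 ltac:(simpl; lia)) as E.
      rewrite Nat.add_0_r, Nat.add_1_r in E. exact E. }
    assert (D2 : partial_quotient al (S (S (S (c k)))) = b k).
    { rewrite Hd. pose proof (digit_seq_right a b U V k 1 ltac:(simpl; lia)) as E.
      rewrite !Nat.add_1_r in E. exact E. }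
    assert (small : forall x, 6 <= x -> / x <= 1 / 6)
      by (intros x Hx; replace (1 / 6) with (/ 6) by lra; apply Rinv_le_contravar; lra).
    pose proof (IZR_le _ _ (Ka k)) as Ka'. pose proof (IZR_le _ _ (Kb k)) as Kb'.
    destruct (m_seq_skip al Irr H1 (S (c k))) as (n & (_ & Hn & _) & Hmn).
    + lia.
    + replace (S (c k) - 1)%nat with (c k) by lia. unfold good_index.
      destruct (complete_quotient_step al Irr (S (c k))) as [_ E].
      rewrite E, Dc. pose proof (cq_range (S (c k))). pose proof (star_range (c k)). lra.
    (* The sum is at most 1 + 1/6 + 1/6, so the index of the digit 1 is skipped. *)
    + unfold good_index. apply Rle_not_lt.
      destruct (complete_quotient_step al Irr (S (S (c k)))) as [_ E].
      rewrite E, D1.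
      destruct (complete_quotient_step al Irr (S (S (S (c k))))) as [_ E'].
      pose proof (cq_range (S (S (S (c k))))).
      pose proof (small (complete_quotient al (S (S (S (c k))))) ltac:(rewrite E', D2; lra)).
      cbn [alpha_star]. rewrite Dc. pose proof (star_range (c k)).
      pose proof (small (IZR (a k) + alpha_star al (c k)) ltac:(lra)). lra.
    + exists n. split.
      * destruct (le_lt_dec N n) as [L|L]; [exact L|exfalso].
        apply (Qseq_lt al Irr H1) in L. rewrite Hn in L.
        replace (S (c k) - 1)%nat with (c k) in L by lia.
        pose proof (cf_den_ge al Irr H1 (c k)). pose proof (c_ge k).
        pose proof (Qseq_ge al Irr H1 N). unfold k in *. lia.
      * rewrite Hmn. pose proof (HG k) as L. apply Rabs_le_between in L.
        pose proof (Kinv k ltac:(unfold k; lia)). lra.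
  (* From here on Q_n > n >= q_{c K}, so a pattern met at [n] has index at least [K]. *)
  - exists (Z.to_nat (cf_den al (c K))). intros n Hn.
    destruct eps as [eps Heps]; cbn [pos] in *.
    destruct (m_seq_cases al Irr H1 n) as (nu & [[_ E]|[(Hnu & Hq & _) E]]); rewrite E.
    + replace (nu + 1)%nat with (S nu) by lia. replace (nu + 2)%nat with (S (S nu)) by lia.
      apply Rlt_le_trans with (25 / 96); [lra|].
      apply F_lower; auto.
      destruct (digit_seq_adjacent a b U V KU KV nu) as [D|D]; rewrite <- Hd in D; auto.
    + destruct nu as [|nu]; [lia|]. replace (S nu + 2)%nat with (S (S (S nu))) by lia.
      pose proof (star_range (S nu)). pose proof (cq_range (S (S nu))).
      destruct (digit_seq_alternate a b U V KU KV nu) as [D|[D|[k Hk]]].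
      (* One argument at least 1/6 gives G >= 7/24, which exceeds 25/96. *)
      * rewrite <- Hd in D. apply star_ge in D. unfold G; lra.
      * rewrite <- Hd in D. apply cq_ge in D. unfold G; lra.
      * fold c in Hk. subst nu.
        assert (K <= k)%nat.
        { destruct (le_lt_dec K k) as [L|L]; [exact L|exfalso].
          pose proof (center_lt a b U V k K L) as HC. fold c in HC.
          pose proof (Qseq_ge al Irr H1 n).
          replace (S (c k) - 1)%nat with (c k) in Hq by lia.
          pose proof (cf_den_le al Irr H1 (c k) (c K) ltac:(lia)).
          destruct (cf_den_pos al Irr (c K)). lia. }
        pose proof (HG k) as L. apply Rabs_le_between in L.
        replace (S (c k) + 2)%nat with (S (S (S (c k)))) in L by lia.
        pose proof (Kinv k ltac:(assumption)). lra.
Qed.
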